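(* Let $b\in\mathbb{R}$, let $m_1,\dots,m_r\ge 1$ be integers with $m_1+\dots+m_r=m$, let $\sigma_1,\dots,\sigma_r\in\{1,-1\}$ and $\lambda_1,\dots,\lambda_r\in\mathbb{R}$, and let $$A=\operatorname{Diag}\{\sigma_1E(m_1),\dots,\sigma_rE(m_r)\},\qquad B=\operatorname{Diag}\{\sigma_1E(m_1)J(\lambda_1,m_1),\dots,\sigma_rE(m_r)J(\lambda_r,m_r)\},$$ $$\hat B=\operatorname{Diag}\{\sigma_1\lambda_1E(m_1),\dots,\sigma_r\lambda_rE(m_r)\}.$$ Consider the optimization problems over $\mathbb{R}^m$ $$(P)\quad \min\ x^{\mathsf T}Bx\ \text{ s.t. }\ x^{\mathsf T}Ax\le b,\qquad\qquad (P^{(\infty)})\quad \min\ y^{\mathsf T}\hat By\ \text{ s.t. }\ y^{\mathsf T}Ay\le b.$$ If $(P)$ is bounded from below, then the optimal value of $(P)$ is equal to the optimal value of $(P^{(\infty)})$.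
   Context: $E(m)\in\mathbb{R}^{m\times m}$ is the matrix with ones on the anti-diagonal (entries $(i,j)$ with $i+j=m+1$) and zeros elsewhere. For $\lambda\in\mathbb{R}$, $J(\lambda,m)\in\mathbb{R}^{m\times m}$ is the Jordan block with $\lambda$ on the diagonal and $1$ on the first superdiagonal. $\operatorname{Diag}\{X_1,\dots,X_r\}$ is the block diagonal matrix with the given square blocks. The optimal value of a problem is the infimum of its objective over the feasible set (with $+\infty$ if the feasible set is empty); bounded from below means that this infimum is not $-\infty$. *)

(* Defs.v *)
From mathcomp Require Import all_boot all_order all_algebra.
From mathcomp Require Import classical_sets reals ereal.

Set Implicit Arguments.
Unset Strict Implicit.
Unset Printing Implicit Defensive.

Import Order.TTheory GRing.Theory Num.Theory.

Local Open Scope ring_scope.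
Local Open Scope classical_set_scope.

(* Indices in 'I_n start at 0, so the 1-based condition i + j = n + 1 of the
   anti-diagonal reads i + j + 1 = n. *)
Definition antidiag_mx (R : pzSemiRingType) (n : nat) : 'M[R]_n :=
  \matrix_(i < n, j < n) ((i + j).+1 == n)%N%:R.

Definition jordan_block (R : pzSemiRingType) (lambda : R) (n : nat) : 'M[R]_n :=
  \matrix_(i < n, j < n) (lambda *+ (i == j) + (i.+1 == j)%N%:R).

Definition qform (R : pzSemiRingType) (n : nat) (M : 'M[R]_n) (x : 'cV[R]_n) : R :=
  (x^T *m M *m x) 0 0.

(* ereal_inf set0 = +oo, the value of an infeasible problem. *)
Definition opt_value (R : realType) (T : Type) (f : T -> R) (S : set T) : \bar R :=
  ereal_inf [set (f x)%:E | x in S].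

Definition bounded_from_below (R : realType) (T : Type) (f : T -> R) (S : set T) : Prop :=
  opt_value f S <> -oo%E.

Definition feasible_set (R : realType) (n : nat) (A : 'M[R]_n) (b : R) :
    set 'cV[R]_n :=
  [set x | qform A x <= b].

(* Main.v *)
Require Import Defs.
From mathcomp Require Import all_boot all_order all_algebra.
From mathcomp Require Import classical_sets reals ereal.
From mathcomp Require Import zify ring lra.

Set Implicit Arguments.
Unset Strict Implicit.
Unset Printing Implicit Defensive.

Import Order.TTheory GRing.Theory Num.Theory.

Local Open Scope ring_scope.
Local Open Scope classical_set_scope.

(** Rescaling the coordinates of a single Jordan block by suitable powers of
    [t] fixes the form of [E(n)] and multiplies the form of [E(n) J(0,n)] by
    [t ^+ 2]. Since [E(n) J(lambda,n) = lambda E(n) + E(n) J(0,n)], performing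
    this in all blocks at once is a linear change of variables that preserves
    the feasible set of [(P)] and carries the objective [Bhat + F] of [(P)] to
    [Bhat + t ^+ 2 F], where [F] gathers the nilpotent parts (see
    [qform_graded]). Hence the optimal value of [(P)] is a lower bound of
    [Bhat(y) + s F(y)] for every feasible [y] and every [s > 0]. Letting [s]
    tend to [0] shows that it is at most [Bhat(y)]; letting [s] tend to
    infinity shows that, when it is not [-oo], [F(y)] is nonnegative, so that
    the objective of [(P)] dominates that of [(P^(oo))] on the feasible set
    ([ray_bounded_below]). *)

(** * The grading of a Jordan block *)

Lemma antidiag_mulmxE (R : pzSemiRingType) (n p : nat) (M : 'M[R]_(n, p))
    (i : 'I_n) (j : 'I_p) :
  (antidiag_mx R n *m M) i j = M (rev_ord i) j.
Proof.
rewrite mxE (bigD1 (rev_ord i)) //= !mxE big1 ?addr0.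
  have -> : (i + (n - i.+1)).+1 = n by case: i => /= i; lia.
  by rewrite eqxx mul1r.
move=> k nek; rewrite !mxE; case: eqP => [ikn|]; last by rewrite mul0r.
case/eqP: nek; apply: val_inj => /=; lia.
Qed.

Lemma antidiag_jordan_block (R : comPzRingType) (c : R) (n : nat) :
  antidiag_mx R n *m jordan_block c n =
  c *: antidiag_mx R n + antidiag_mx R n *m jordan_block 0 n.
Proof.
have -> : jordan_block c n = c%:M + jordan_block 0 n.
  by apply/matrixP => i j; rewrite !mxE mul0rn add0r.
by rewrite mulmxDr mul_mx_scalar.
Qed.

(** The exponents [2 k + 1 - n] are symmetric about [0], so that the weights of
    indices paired by the antidiagonal are inverse to each other; doubling the
    natural exponents [k - (n - 1) / 2] keeps them integral. *)
Definition grading_mx (R : fieldType) (t : R) (n : nat) : 'M[R]_n :=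
  diag_mx (\row_(k < n) (t ^+ (k.*2).+1 / t ^+ n)).

Lemma grading_mx_congrE (R : fieldType) (t : R) (n : nat) (M : 'M[R]_n)
    (i j : 'I_n) :
  ((grading_mx t n)^T *m M *m grading_mx t n) i j =
  t ^+ (i + j).+1.*2 / t ^+ n.*2 * M i j.
Proof.
rewrite /grading_mx tr_diag_mx mul_mx_diag mxE mul_diag_mx !mxE.
have -> : (i + j).+1.*2 = ((i.*2).+1 + (j.*2).+1)%N by lia.
by rewrite -(addnn n) !exprD invfM; ring.
Qed.

Lemma grading_mx_antidiag (R : fieldType) (t : R) (n : nat) :
  t != 0 ->
  (grading_mx t n)^T *m antidiag_mx R n *m grading_mx t n = antidiag_mx R n.
Proof.
move=> t0; apply/matrixP => i j; rewrite grading_mx_congrE mxE.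
case: eqP => [->|_]; last by rewrite mulr0.
by rewrite divff ?mul1r // expf_neq0.
Qed.

(** The nonzero entries of [E(n) J(0,n)] lie one step below the antidiagonal,
    where the product of the two weights is [t ^+ 2]. *)
Lemma grading_mx_nilpotent (R : fieldType) (t : R) (n : nat) :
  t != 0 ->
  let N := antidiag_mx R n *m jordan_block 0 n in
  (grading_mx t n)^T *m N *m grading_mx t n = t ^+ 2 *: N.
Proof.
move=> t0 N; apply/matrixP => i j; rewrite grading_mx_congrE [RHS]mxE.
rewrite antidiag_mulmxE mxE mul0rn add0r.
case: eqP => [/= ij|_]; last by rewrite !mulr0.
have -> : (i + j).+1.*2 = (2 + n.*2)%N by case: i ij => /= i; lia.
by rewrite exprD mulfK // expf_neq0.
Qed.

(** * Block diagonal forms under the grading *)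

Lemma qform_mulmx (R : comPzRingType) (n : nat) (M D : 'M[R]_n) (x : 'cV[R]_n) :
  qform M (D *m x) = qform (D^T *m M *m D) x.
Proof. by rewrite /qform trmx_mul !mulmxA. Qed.

Lemma qformD (R : pzSemiRingType) (n : nat) (M N : 'M[R]_n) (x : 'cV[R]_n) :
  qform (M + N) x = qform M x + qform N x.
Proof. by rewrite /qform mulmxDr mulmxDl mxE. Qed.

Lemma qformZ (R : comPzRingType) (n : nat) (c : R) (M : 'M[R]_n)
    (x : 'cV[R]_n) :
  qform (c *: M) x = c * qform M x.
Proof. by rewrite /qform -scalemxAr -scalemxAl mxE. Qed.

Lemma mul_mxdiag_mxdiag (R : pzSemiRingType) (r : nat) (m : 'I_r -> nat)
    (M N : forall i, 'M[R]_(m i)) :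
  \mxdiag_i M i *m \mxdiag_i N i = \mxdiag_i (M i *m N i).
Proof.
rewrite [X in _ *m X]/mxdiag mul_mxdiag_mxblock /mxdiag.
apply/eq_mxblockP => i j; case: eqVneq => [ij|_]; last by rewrite mulmx0.
by case: j / ij; rewrite !conform_mx_id.
Qed.

Lemma mxdiag_scale (R : pzSemiRingType) (r : nat) (m : 'I_r -> nat) (c : R)
    (M : forall i, 'M[R]_(m i)) :
  \mxdiag_i (c *: M i) = c *: \mxdiag_i M i.
Proof.
rewrite -mul_scalar_mx -mxdiagZ mul_mxdiag_mxdiag.
by apply: eq_mxdiag => i; rewrite mul_scalar_mx.
Qed.

(** Block diagonality lets the blocks be rescaled simultaneously with the same
    [t], so that a factor common to all blocks comes out of the whole form. *)
Lemma qform_graded (R : fieldType) (t c : R) (r : nat) (m : 'I_r -> nat)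
    (M : forall i, 'M[R]_(m i)) (x : 'cV[R]_(\sum_(i < r) m i)) :
  (forall i, (grading_mx t (m i))^T *m M i *m grading_mx t (m i) = c *: M i) ->
  qform (\mxdiag_i M i) (\mxdiag_i grading_mx t (m i) *m x) =
  c * qform (\mxdiag_i M i) x.
Proof.
move=> hM; rewrite qform_mulmx tr_mxdiag !mul_mxdiag_mxdiag.
by rewrite (eq_mxdiag hM) mxdiag_scale qformZ.
Qed.

(** * Comparison of the two optimal values *)

(** The infimum of [u + s v] over [s > 0] is [u] or [-oo]: the two conclusions
    come from [s] near [0] and from large [s]. *)
Lemma ray_bounded_below (R : realFieldType) (p u v : R) :
  (forall s, 0 < s -> p <= u + s * v) -> p <= u /\ 0 <= v.
Proof.
move=> h; split.
  apply/ler_addgt0Pr => e e0.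
  (* the increment [s * v] is at most [e] for this [s] *)
  have hs : 0 < e / (`|v| + 1) by rewrite divr_gt0 // ltr_wpDl.
  apply: le_trans (h _ hs) _; rewrite lerD2l mulrAC ler_pdivrMr ?ltr_wpDl //.
  by rewrite ler_pM2l // (le_trans (ler_norm v)) // lerDl.
rewrite leNgt; apply/negP => v0.
(* this [s] makes [u + s * v] equal to [u - `|p - u| - 1], below [p] *)
have hs : 0 < (`|p - u| + 1) / - v by rewrite divr_gt0 ?oppr_gt0 // ltr_wpDl.
have := h _ hs; rewrite invrN mulrN mulNr divfK ?lt_eqF //.
have := ler_norm (u - p); rewrite distrC; lra.
Qed.

Theorem theorem7p4 (R : realType) (b : R) (r : nat) (hr : (0 < r)%N)
    (m : 'I_r -> nat) (hm : forall i : 'I_r, (1 <= m i)%N)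
    (sigma lambda : 'I_r -> R)
    (hsigma : forall i : 'I_r, sigma i = 1 \/ sigma i = -1) :
  let A : 'M[R]_(\sum_(i < r) m i) :=
    \mxdiag_(i < r) (sigma i *: antidiag_mx R (m i)) in
  let B : 'M[R]_(\sum_(i < r) m i) :=
    \mxdiag_(i < r)
      (sigma i *: (antidiag_mx R (m i) *m jordan_block (lambda i) (m i))) in
  let Bhat : 'M[R]_(\sum_(i < r) m i) :=
    \mxdiag_(i < r) ((sigma i * lambda i) *: antidiag_mx R (m i)) in
  bounded_from_below (qform B) (feasible_set A b) ->
  opt_value (qform B) (feasible_set A b) =
  opt_value (qform Bhat) (feasible_set A b).
Proof.
move=> A B Bhat bnd.
pose F : 'M[R]_(\sum_(i < r) m i) := \mxdiag_(i < r)
  (sigma i *: (antidiag_mx R (m i) *m jordan_block 0 (m i))).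
have BE x : qform B x = qform Bhat x + qform F x.
  rewrite -qformD /B /Bhat /F -mxdiagD; congr qform; apply: eq_mxdiag => i.
  by rewrite antidiag_jordan_block scalerDr scalerA.
have ray y s : feasible_set A b y -> 0 < s ->
    (opt_value (qform B) (feasible_set A b) <= (qform Bhat y + s * qform F y)%:E)%E.
  move=> Ay s0; pose t := Num.sqrt s.
  have t0 : t != 0 by rewrite sqrtr_eq0 -ltNge.
  have invariant (c : 'I_r -> R) :
      qform (\mxdiag_i (c i *: antidiag_mx R (m i)))
            (\mxdiag_i grading_mx t (m i) *m y) =
      qform (\mxdiag_i (c i *: antidiag_mx R (m i))) y.
    rewrite (qform_graded (c := 1)) ?mul1r // => i.
    by rewrite -scalemxAr -scalemxAl grading_mx_antidiag ?scale1r.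
  apply: ereal_inf_lbound; exists (\mxdiag_i grading_mx t (m i) *m y).
    by rewrite /feasible_set /= invariant.
  rewrite BE invariant (qform_graded (c := s)) // => i.
  rewrite -scalemxAr -scalemxAl grading_mx_nilpotent // sqr_sqrtr ?ltW //.
  by rewrite !scalerA mulrC.
have bounds y : feasible_set A b y ->
    (opt_value (qform B) (feasible_set A b) <= (qform Bhat y)%:E)%E /\
    0 <= qform F y.
  move=> Ay; move: bnd (ray y ^~ Ay); rewrite /bounded_from_below.
  case: (opt_value _ _) => [p _ h|_ /(_ 1 ltr01)|//]; last by rewrite leNgt ltry.
  by rewrite lee_fin; apply: ray_bounded_below => s /h; rewrite lee_fin.
apply/eqP; rewrite eq_le; apply/andP; split.
  by apply: le_ereal_inf_tmp => _ [y /bounds[+ _] <-].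
apply: le_ereal_inf_tmp => _ [y Ay <-].
have [_ Fy] := bounds y Ay.
apply: le_trans (_ : ((qform Bhat y)%:E <= _)%E).
  by apply: ereal_inf_lbound; exists y.
by rewrite lee_fin BE lerDl.
Qed.
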